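(* Let $\bar T=\rho_4(\tau)$ and $D=\rho_4(\Delta)$, where $\tau=\sigma_1\sigma_2\sigma_3$ and $\Delta=\sigma_1\sigma_2\sigma_3\sigma_1\sigma_2\sigma_1$ in $B_4$. The reduced Burau representation $\rho_4:B_4\to GL\left(3,\mathbb{Z}[t,t^{-1}]\right)$ is faithful (injective) if and only if, for all $m\in\mathbb{Z}$, all integers $k\ge1$ and all $i_1,\dots,i_k\in\{1,2,3\}$, the matrix product $$t^{4m}\,\bar T^2\,D\,\bar T^{i_1}\,D\,\bar T^{i_2}\,D\cdots D\,\bar T^{i_k}\,D\,\bar T^2$$ is not the identity matrix.
   Context: $B_4$ is the braid group on four strands with standard generators $\sigma_1,\sigma_2,\sigma_3$ and relations $\sigma_1\sigma_2\sigma_1=\sigma_2\sigma_1\sigma_2$, $\sigma_2\sigma_3\sigma_2=\sigma_3\sigma_2\sigma_3$, $\sigma_1\sigma_3=\sigma_3\sigma_1$. The reduced Burau representation $\rho_4$ is given on generators by $$\rho_4(\sigma_1)=\begin{bmatrix}-t&t&0\\0&1&0\\0&0&1\end{bmatrix},\quad \rho_4(\sigma_2)=\begin{bmatrix}1&0&0\\1&-t&t\\0&0&1\end{bmatrix},\quad \rho_4(\sigma_3)=\begin{bmatrix}1&0&0\\0&1&0\\0&1&-t\end{bmatrix}.$$ The convention is ''left multiplication of matrices'': the matrix of a product of braids is formed by successively multiplying on the left, i.e. in terms of the ordinary matrix product $\rho_4(xy)=\rho_4(y)\rho_4(x)$ for all $x,y\in B_4$ (equivalently, $\rho_4$ is a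 homomorphism into $GL(3,\mathbb{Z}[t,t^{-1}])$ with the opposite multiplication). Since the condition in the claim ranges over all tuples $(i_1,\dots,i_k)$ and the displayed product is symmetric up to reversing the tuple, it does not matter whether the displayed product is read with the ordinary or the opposite multiplication. *)

(* Defs.v *)
From HB Require Import structures.
From mathcomp Require Import all_boot all_order all_algebra.
From mathcomp Require Import boolp ring.

Set Implicit Arguments.
Unset Strict Implicit.
Unset Printing Implicit Defensive.

Import GRing.Theory.
Local Open Scope ring_scope.

(* Z[t, t^-1], realised as the subring of the fraction field Q(t) of Z[t]
   formed by the p(t) / t^n with p in Z[t]. *)

Definition is_laurent (x : {fraction {poly int}}) : bool :=
  `[< exists (p : {poly int}) (n : nat),
        x = FracField.tofrac p / FracField.tofrac 'X ^+ n >].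

Fact is_laurentP (x : {fraction {poly int}}) :
  reflect (exists (p : {poly int}) (n : nat),
             x = FracField.tofrac p / FracField.tofrac 'X ^+ n)
          (x \in is_laurent).
Proof. exact: asboolP. Qed.

Fact fracX_neq0 : FracField.tofrac ('X : {poly int}) != 0.
Proof. by rewrite tofrac_eq0 polyX_eq0. Qed.

Fact is_laurent_subring : subring_closed is_laurent.
Proof.
have X0 := fracX_neq0.
split.
- by apply/is_laurentP; exists 1, 0%N; rewrite tofrac1 expr0 divr1.
- move=> _ _ /is_laurentP[p [m ->]] /is_laurentP[q [n ->]].
  apply/is_laurentP; exists (p * 'X^n - q * 'X^m), (m + n)%N.
  by rewrite tofracB !tofracM !tofracXn exprD -mulNr addf_div ?expf_neq0 // mulNr.
- move=> _ _ /is_laurentP[p [m ->]] /is_laurentP[q [n ->]].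
  apply/is_laurentP; exists (p * q), (m + n)%N.
  by rewrite tofracM exprD mulf_div.
Qed.

HB.instance Definition _ :=
  GRing.isSubringClosed.Build {fraction {poly int}} is_laurent
    is_laurent_subring.

Record laurent : Type := Laurent {
  laurent_val :> {fraction {poly int}};
  laurent_valP : laurent_val \in is_laurent }.

HB.instance Definition _ := [isSub for laurent_val].
HB.instance Definition _ := [Choice of laurent by <:].
HB.instance Definition _ := [SubChoice_isSubComNzRing of laurent by <:].

Fact laurent_val0 : laurent_val 0 = 0. Proof. exact: (rmorph0 val). Qed.
Fact laurent_val1 : laurent_val 1 = 1. Proof. exact: (rmorph1 val). Qed.
Fact laurent_valM (x y : laurent) :
  laurent_val (x * y) = laurent_val x * laurent_val y.
Proof. exact: (rmorphM val). Qed.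
Fact laurent_val_inj : injective laurent_val.
Proof. exact: val_inj. Qed.

Definition laurent_unit : {pred laurent} :=
  fun x => (laurent_val x != 0) && ((laurent_val x)^-1 \in is_laurent).

Definition laurent_inv (x : laurent) : laurent :=
  if x \in laurent_unit then insubd x (laurent_val x)^-1 else x.

Fact laurent_mulVx : {in laurent_unit, left_inverse 1 laurent_inv *%R}.
Proof.
move=> x Ux; apply: laurent_val_inj; rewrite laurent_valM laurent_val1.
rewrite /laurent_inv Ux; case/andP: Ux => x0 Vx.
by rewrite [laurent_val (insubd _ _)](insubdK x Vx) mulVf.
Qed.

Fact laurent_unitP (x y : laurent) : y * x = 1 -> x \in laurent_unit.
Proof.
move=> /(congr1 laurent_val); rewrite laurent_valM laurent_val1 => yx1.
have x0 : laurent_val x != 0.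
  by apply/eqP => x0; move/eqP: yx1; rewrite x0 mulr0 eq_sym oner_eq0.
apply/andP; split=> //; suff -> : (laurent_val x)^-1 = laurent_val y.
  exact: laurent_valP.
by apply: (mulIf x0); rewrite mulVf.
Qed.

Fact laurent_inv_out : {in [predC laurent_unit], laurent_inv =1 id}.
Proof. by move=> x; rewrite inE /laurent_inv => /negbTE ->. Qed.

HB.instance Definition _ := GRing.ComNzRing_hasMulInverse.Build laurent
  laurent_mulVx laurent_unitP laurent_inv_out.

Fact laurent_idomain (x y : laurent) : x * y = 0 -> (x == 0) || (y == 0).
Proof.
move=> /(congr1 laurent_val); rewrite laurent_valM laurent_val0 => /eqP.
rewrite mulf_eq0 => /orP[] /eqP e; apply/orP; [left|right];
  by apply/eqP/laurent_val_inj; rewrite e laurent_val0.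
Qed.

HB.instance Definition _ :=
  GRing.ComUnitRing_isIntegral.Build laurent laurent_idomain.

Fact laurentX_subproof : FracField.tofrac ('X : {poly int}) \in is_laurent.
Proof. by apply/is_laurentP; exists 'X, 0%N; rewrite expr0 divr1. Qed.

Definition laurentX : laurent := Laurent laurentX_subproof.

Fact laurentX_unit : laurentX \is a GRing.unit.
Proof.
apply/andP; split; first exact: fracX_neq0.
by apply/is_laurentP; exists 1, 1%N; rewrite tofrac1 expr1 mul1r.
Qed.

(* The group law on GL(3, Z[t, t^-1]) is the ordinary matrix product. *)

Record GL3 : Type := MkGL3 {
  GL3_val :> 'M[laurent]_3;
  GL3_valP : GL3_val \in unitmx }.

HB.instance Definition _ := [isSub for GL3_val].
HB.instance Definition _ := [Choice of GL3 by <:].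

Fact GL3_mul_subproof (A B : GL3) : A *m B \in unitmx.
Proof. by rewrite unitmx_mul !GL3_valP. Qed.

Fact GL3_inv_subproof (A : GL3) : invmx A \in unitmx.
Proof. by rewrite unitmx_inv GL3_valP. Qed.

Definition GL3_one : GL3 := MkGL3 (unitmx1 laurent 3).
Definition GL3_mul (A B : GL3) : GL3 := MkGL3 (GL3_mul_subproof A B).
Definition GL3_inv (A : GL3) : GL3 := MkGL3 (GL3_inv_subproof A).

Fact GL3_mulA : associative GL3_mul.
Proof. by move=> A B C; apply: val_inj; exact: mulmxA. Qed.
Fact GL3_mul1 : left_id GL3_one GL3_mul.
Proof. by move=> A; apply: val_inj; exact: mul1mx. Qed.
Fact GL3_mulr1 : right_id GL3_one GL3_mul.
Proof. by move=> A; apply: val_inj; exact: mulmx1. Qed.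
Fact GL3_mulV : left_inverse GL3_one GL3_inv GL3_mul.
Proof. by move=> A; apply: val_inj; exact: mulVmx (GL3_valP A). Qed.
Fact GL3_mulrV : right_inverse GL3_one GL3_inv GL3_mul.
Proof. by move=> A; apply: val_inj; exact: mulmxV (GL3_valP A). Qed.

HB.instance Definition _ :=
  isGroup.Build GL3 GL3_mulA GL3_mul1 GL3_mulr1 GL3_mulV GL3_mulrV.

(* B_4 is the quotient of the words in the letters sigma_i^{+-1} by the
   congruence generated by free cancellation and the braid relations.  The
   letter (i, true) stands for sigma_{i+1}, (i, false) for its inverse. *)

Definition letter : Type := ('I_3 * bool)%type.
Definition word : Type := seq letter.
HB.instance Definition _ := Choice.on word.

Definition inv_letter (g : letter) : letter := (g.1, ~~ g.2).

Definition gen1 : letter := (@Ordinal 3 0 isT, true).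
Definition gen2 : letter := (@Ordinal 3 1 isT, true).
Definition gen3 : letter := (@Ordinal 3 2 isT, true).

Inductive braid_eq : word -> word -> Prop :=
| braid_refl u : braid_eq u u
| braid_sym u v : braid_eq u v -> braid_eq v u
| braid_trans v u w : braid_eq u v -> braid_eq v w -> braid_eq u w
| braid_cat u u' v v' :
    braid_eq u u' -> braid_eq v v' -> braid_eq (u ++ v) (u' ++ v')
| braid_cancel g : braid_eq [:: g; inv_letter g] [::]
| braid_121 : braid_eq [:: gen1; gen2; gen1] [:: gen2; gen1; gen2]
| braid_232 : braid_eq [:: gen2; gen3; gen2] [:: gen3; gen2; gen3]
| braid_13 : braid_eq [:: gen1; gen3] [:: gen3; gen1].

Definition braid_eqb (u v : word) : bool := `[< braid_eq u v >].

Fact braid_eqb_refl : reflexive braid_eqb.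
Proof. by move=> u; apply/asboolP; exact: braid_refl. Qed.
Fact braid_eqb_sym : symmetric braid_eqb.
Proof. by move=> u v; apply/asboolP/asboolP; exact: braid_sym. Qed.
Fact braid_eqb_trans : transitive braid_eqb.
Proof.
by move=> v u w /asboolP uv /asboolP vw; apply/asboolP; exact: braid_trans vw.
Qed.

Canonical braid_equiv :=
  EquivRel braid_eqb braid_eqb_refl braid_eqb_sym braid_eqb_trans.

Definition B4 : Type := {eq_quot braid_eqb}%qT.
HB.instance Definition _ := Choice.on B4.
HB.instance Definition _ := EqQuotient.on B4.

Definition braid_class (u : word) : B4 := \pi_B4%qT u.

Fact braid_classP (u v : word) : braid_class u = braid_class v <-> braid_eq u v.
Proof. by split=> [/eqmodP/asboolP|uv] //; apply/eqmodP/asboolP. Qed.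

Fact braid_class_repr (x : B4) : braid_class (repr x) = x.
Proof. exact: reprK. Qed.

Definition inv_word (u : word) : word := rev (map inv_letter u).

Fact inv_letterK : involutive inv_letter.
Proof. by case=> i b; rewrite /inv_letter /= negbK. Qed.

Fact inv_wordK : involutive inv_word.
Proof. by move=> u; rewrite /inv_word map_rev revK mapK //; exact: inv_letterK. Qed.

Fact braid_mulV (u : word) : braid_eq (u ++ inv_word u) [::].
Proof.
elim: u => [|g u IH]; first exact: braid_refl.
have -> : (g :: u) ++ inv_word (g :: u)
    = ([:: g] ++ (u ++ inv_word u)) ++ [:: inv_letter g].
  by rewrite /inv_word /= rev_cons -cats1 catA.
apply: (braid_trans (v := ([:: g] ++ [::]) ++ [:: inv_letter g])).
  by apply: braid_cat; [apply: braid_cat|]; try exact: braid_refl.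
exact: braid_cancel.
Qed.

Fact braid_Vmul (u : word) : braid_eq (inv_word u ++ u) [::].
Proof. by have := braid_mulV (inv_word u); rewrite inv_wordK. Qed.

Definition B4_one : B4 := braid_class [::].
Definition B4_mul (x y : B4) : B4 := braid_class (repr x ++ repr y).
Definition B4_inv (x : B4) : B4 := braid_class (inv_word (repr x)).

Fact braid_repr (u : word) : braid_eq (repr (braid_class u)) u.
Proof. by apply/braid_classP; rewrite braid_class_repr. Qed.

Fact B4_mulE (u v : word) :
  B4_mul (braid_class u) (braid_class v) = braid_class (u ++ v).
Proof. by apply/braid_classP; apply: braid_cat; exact: braid_repr. Qed.

Fact B4_mulA : associative B4_mul.
Proof.
move=> x y z; rewrite -[x]braid_class_repr -[y]braid_class_repr.
by rewrite -[z]braid_class_repr !B4_mulE catA.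
Qed.
Fact B4_mul1 : left_id B4_one B4_mul.
Proof. by move=> x; rewrite -[x]braid_class_repr B4_mulE. Qed.
Fact B4_mulr1 : right_id B4_one B4_mul.
Proof. by move=> x; rewrite -[x]braid_class_repr B4_mulE cats0. Qed.
Fact B4_mulV : left_inverse B4_one B4_inv B4_mul.
Proof.
move=> x; rewrite -{2}[x]braid_class_repr B4_mulE.
by apply/braid_classP; exact: braid_Vmul.
Qed.
Fact B4_mulrV : right_inverse B4_one B4_inv B4_mul.
Proof.
move=> x; rewrite -{1}[x]braid_class_repr B4_mulE.
by apply/braid_classP; exact: braid_mulV.
Qed.

HB.instance Definition _ :=
  isGroup.Build B4 B4_mulA B4_mul1 B4_mulr1 B4_mulV B4_mulrV.

Definition sigma1 : B4 := braid_class [:: gen1].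
Definition sigma2 : B4 := braid_class [:: gen2].
Definition sigma3 : B4 := braid_class [:: gen3].

Section BurauMatrices.
Variables (R : comNzRingType) (t : R).

Definition mx3 (rows : seq (seq R)) : 'M[R]_3 :=
  \matrix_(i < 3, j < 3) nth 0 (nth [::] rows i) j.

Definition burau1 : 'M[R]_3 :=
  mx3 [:: [:: - t; t; 0];
          [:: 0;   1; 0];
          [:: 0;   0; 1]].

Definition burau2 : 'M[R]_3 :=
  mx3 [:: [:: 1;   0; 0];
          [:: 1; - t; t];
          [:: 0;   0; 1]].

Definition burau3 : 'M[R]_3 :=
  mx3 [:: [:: 1; 0;   0];
          [:: 0; 1;   0];
          [:: 0; 1; - t]].

Definition burau_mx (i : 'I_3) : 'M[R]_3 :=
  match val i with 0 => burau1 | 1 => burau2 | _ => burau3 end%N.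

Fact det_burau_mx (i : 'I_3) : \det (burau_mx i) = - t.
Proof.
rewrite (expand_det_row _ ord0) !big_ord_recl big_ord0 /cofactor.
rewrite !(expand_det_row _ ord0) !big_ord_recl !big_ord0 /cofactor !det_mx11.
by case: i => [[|[|[|//]]] ?]; rewrite /burau_mx /= !mxE /=; ring.
Qed.

Ltac mx3_calc :=
  apply/matrixP=> -[[|[|[|//]]] ?] [[|[|[|//]]] ?];
  rewrite !(mxE, big_ord_recl, big_ord0) /=; ring.

Fact burau_121 : burau1 *m burau2 *m burau1 = burau2 *m burau1 *m burau2.
Proof. mx3_calc. Qed.
Fact burau_232 : burau2 *m burau3 *m burau2 = burau3 *m burau2 *m burau3.
Proof. mx3_calc. Qed.
Fact burau_13 : burau1 *m burau3 = burau3 *m burau1.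
Proof. mx3_calc. Qed.

End BurauMatrices.

Fact burau_unit (i : 'I_3) : burau_mx laurentX i \in unitmx.
Proof. by rewrite unitmxE det_burau_mx unitrN laurentX_unit. Qed.

Definition burau (i : 'I_3) : GL3 := MkGL3 (burau_unit i).

Definition burau_letter (g : letter) : GL3 :=
  if g.2 then burau g.1 else ((burau g.1)^-1)%g.

(* Products are reversed: rho_4 (x y) = rho_4 (y) rho_4 (x). *)
Definition burau_word (u : word) : GL3 :=
  foldr (fun g A => A * burau_letter g)%g 1%g u.

Definition rho4 (x : B4) : GL3 := burau_word (repr x).

Fact burau_word_cat (u v : word) :
  burau_word (u ++ v) = (burau_word v * burau_word u)%g.
Proof. by elim: u => [|g u IH] /=; rewrite ?mulg1 // IH mulgA. Qed.

Fact burau_word_eq (u v : word) : braid_eq u v -> burau_word u = burau_word v.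
Proof.
elim=> {u v} //=.
- by move=> v u w _ -> _ ->.
- by move=> u u' v v' _ Eu _ Ev; rewrite !burau_word_cat Eu Ev.
- case=> i b; rewrite mul1g /burau_letter /=.
  by case: b => /=; rewrite ?mulVg ?mulgV.
- rewrite !mul1g; apply: val_inj; exact: burau_121.
- rewrite !mul1g; apply: val_inj; exact: burau_232.
- rewrite !mul1g; apply: val_inj; exact/esym/burau_13.
Qed.

Fact rho4_class (u : word) : rho4 (braid_class u) = burau_word u.
Proof. by apply: burau_word_eq; exact: braid_repr. Qed.

Fact rho4M (x y : B4) : rho4 (x * y)%g = (rho4 y * rho4 x)%g.
Proof.
rewrite -[x]braid_class_repr -[y]braid_class_repr.
by rewrite [(_ * _)%g]B4_mulE !rho4_class burau_word_cat.
Qed.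

Fact rho4_sigma1 : rho4 sigma1 = burau1 laurentX :> 'M[laurent]_3.
Proof. by rewrite rho4_class; exact: mul1mx. Qed.
Fact rho4_sigma2 : rho4 sigma2 = burau2 laurentX :> 'M[laurent]_3.
Proof. by rewrite rho4_class; exact: mul1mx. Qed.
Fact rho4_sigma3 : rho4 sigma3 = burau3 laurentX :> 'M[laurent]_3.
Proof. by rewrite rho4_class; exact: mul1mx. Qed.

Definition tau : B4 := (sigma1 * sigma2 * sigma3)%g.
Definition Delta : B4 := (sigma1 * sigma2 * sigma3 * sigma1 * sigma2 * sigma1)%g.

(* Main.v *)
Require Import Defs.
From HB Require Import structures.
From mathcomp Require Import all_boot all_order all_algebra.
From mathcomp Require Import boolp ring lra.
Import GRing.Theory.
Import Num.Theory Order.TTheory.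
Local Open Scope ring_scope.

(** Put z = tau^4 = Delta^2, which is central and is sent to the scalar t^4.
    Up to powers of z and conjugation by tau^2, the products in the theorem are
    the images of the words Delta tau^i1 Delta ... Delta tau^ik Delta with all
    i_j in {1, 2, 3} ([burau_product_group]); rho_4 reverses words, which only
    reverses the exponents.

    Faithful implies that no product is trivial.  If one were, the corresponding
    braid word would be a power of z in B_4.  It is not, since tau and Delta
    generate modulo z a free product of Z/4 and Z/2.  To see this, let B_4 act
    on the pairs of elements of an arbitrary group G by substitution in the two
    generators of a free group.  If x, y in G satisfy x^4 = y^2, then on the
    pair (x^2 y^-1, x^3 y^-1 x^-1) the braids tau and Delta act as conjugation
    by x and y, so any word in tau and Delta acts as conjugation by the same
    word in x and y ([tracks_alternating]).  Two rational matrices x, y that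
    generate a Hecke triangle group turn the question into a positivity
    property of 2 x 2 matrices ([alternating_braid_neq]).

    If no product is trivial then rho_4 is faithful.  The hypothesis makes
    rho_4 injective on H = <tau, Delta>: an element of H is, up to z, a power of
    tau or tau^j w tau^e with w an alternating word, and multiplying by suitable
    powers of tau and by Delta on both sides reduces the latter case to a
    product in the theorem ([alternating_form_neq]).  It remains to see that
    the kernel lies in H ([rho4_ker_generated]).  At t = -1 the representation
    has a two-dimensional quotient through SL_2(Z), in which H acts by powers of
    a quarter turn.  Every braid is h m tau^e with h in H, e in {0, 1}, and m a
    product of copies of sigma_1 and sigma_2^-1 ([positive_decomposition]); the
    generators of this monoid act by nonnegative unipotent matrices, so a kernel
    element must have m = 1. *)

(** * Subgroup and submonoid generated by two elements *)

Inductive generated (G : groupType) (x y : G) : G -> Prop :=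
| generated_1 : generated G x y 1%g
| generated_x : generated G x y x
| generated_y : generated G x y y
| generated_M g h :
    generated G x y g -> generated G x y h -> generated G x y (g * h)%g
| generated_V g : generated G x y g -> generated G x y g^-1%g.

Inductive submonoid (G : groupType) (x y : G) : G -> Prop :=
| submonoid_1 : submonoid G x y 1%g
| submonoid_x g : submonoid G x y g -> submonoid G x y (g * x)%g
| submonoid_y g : submonoid G x y g -> submonoid G x y (g * y)%g.

(** * Braids on four strands *)

(** The identities are derived for arbitrary elements subject to the braid
    relations, so that tau and Delta are variables that rewriting does not
    unfold.  The elements c and d generate the kernel of the homomorphism from
    B_4 to B_3 that identifies sigma_1 and sigma_3. *)
Section FourStrandRelations.
Local Open Scope group_scope.
Variables (G : groupType) (s1 s2 s3 t D c d : G).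
Hypotheses (sigma_121 : s1 * s2 * s1 = s2 * s1 * s2)
  (sigma_232 : s2 * s3 * s2 = s3 * s2 * s3) (sigma_13 : s1 * s3 = s3 * s1).
Hypotheses (tauE : t = s1 * s2 * s3) (DeltaE : D = t * (s1 * s2 * s1)).
Hypotheses (cE : c = s1 * s3^-1) (dE : d = t * c * t^-1).

Lemma tau_sigma1 : t * s1 = s2 * t.
Proof. by rewrite tauE -mulgA -sigma_13 !mulgA sigma_121. Qed.

Lemma tau_sigma2 : t * s2 = s3 * t.
Proof.
have -> : t * s2 = s1 * (s2 * s3 * s2) by rewrite tauE !mulgA.
by rewrite sigma_232 tauE !mulgA sigma_13.
Qed.

Lemma sigma1_sigma2 : s1 * s2 = t * s3^-1.
Proof. by rewrite tauE mulgK. Qed.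

Lemma sigma1_Delta : s1 * D = t ^+ 2 * s1.
Proof.
have -> : s1 * D = s1 * (t * s1) * s2 * s1 by rewrite DeltaE !mulgA.
rewrite tau_sigma1 -[_ * _ * s2]mulgA -[_ * t * _]mulgA tau_sigma2.
by rewrite expg2 {2}tauE !mulgA.
Qed.

Lemma Delta_sigma3 : D * s3 = s1 * D.
Proof.
rewrite sigma1_Delta DeltaE expg2 -!mulgA sigma_13.
by congr (_ * _); rewrite tauE !mulgA.
Qed.

Lemma tau2_sigma1 : t ^+ 2 * s1 = s3 * t ^+ 2.
Proof. by rewrite expg2 -mulgA tau_sigma1 mulgA tau_sigma2 mulgA. Qed.

(** This places c in <tau, Delta>. *)
Lemma tau2E : t ^+ 2 = c * D.
Proof.
apply: (mulgI s3); rewrite -tau2_sigma1 -sigma1_Delta cE !mulgA.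
by rewrite -sigma_13 mulgK.
Qed.

Lemma c_sigma1 : s1 * c = c * s1.
Proof.
by rewrite cE -!mulgA; congr (_ * _); exact: (commuteV sigma_13).
Qed.

Lemma c_sigma3 : s3 * c = c * s3.
Proof. by rewrite cE mulgA -sigma_13 mulgK mulgVK. Qed.

Lemma Delta_sigma1 : D * s1 = s3 * D.
Proof.
apply: (mulgI c).
by rewrite mulgA -tau2E tau2_sigma1 tau2E !mulgA c_sigma3.
Qed.

Lemma Delta_c : D * c = c^-1 * D.
Proof.
rewrite cE invgF mulgA Delta_sigma1.
apply: (mulIg s3); rewrite mulgVK -!mulgA Delta_sigma3 mulgA.
by rewrite [RHS]mulgA mulgVK.
Qed.

Lemma tau4E : t ^+ 4 = D ^+ 2.
Proof.
by rewrite (expgnDr t 2 2) tau2E -mulgA [D * _]mulgA Delta_c !mulgA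
  mulgV mul1g.
Qed.

Lemma d_tau : d * t = s1 * s2 * s1.
Proof.
by rewrite dE mulgVK cE mulgA tau_sigma1 -mulgA -sigma1_sigma2 mulgA
  sigma_121.
Qed.

Lemma sigma1_d : s1 * d = d * s3.
Proof.
apply: (mulIg t); rewrite -!mulgA -tau_sigma2 d_tau [RHS]mulgA d_tau.
by rewrite -[in RHS]mulgA -[in RHS]mulgA; congr (_ * _);
  rewrite mulgA sigma_121.
Qed.

Lemma conj_sigma1_c : s1 * c * s1^-1 = c.
Proof. by rewrite c_sigma1 mulgK. Qed.

Lemma conj_sigma1_d : s1 * d * s1^-1 = d * c^-1.
Proof. by rewrite sigma1_d cE invgF mulgA. Qed.

Lemma conj_sigma1_tau2 : s1 * t ^+ 2 * s1^-1 = c * t ^+ 2.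
Proof.
apply: (mulIg s1); rewrite mulgVK cE -[RHS]mulgA tau2_sigma1 [RHS]mulgA.
by rewrite mulgVK.
Qed.

Lemma conj_tau_d : t * d * t^-1 = c^-1.
Proof.
apply: (mulIg t); rewrite mulgVK dE; apply: (mulIg t).
rewrite !mulgA mulgVK -[RHS]mulgA -expg2 tau2E -[c * _ * _]mulgA.
by rewrite Delta_c !mulgA mulgV mulVg.
Qed.

(** Generation by sigma_1 and tau, as an induction principle. *)
Hypothesis gen_ind : forall P : G -> Prop, P 1 ->
  (forall g, P g -> [/\ P (g * s1), P (g * s1^-1), P (g * t) & P (g * t^-1)]) ->
  forall g, P g.

Local Notation H := (generated G t D).

(** Conjugation by sigma_1 and by tau preserves the subgroup generated by c, d
    and tau^2: sigma_1 fixes c and sends d to d c^-1 and tau^2 to c tau^2, while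
    tau sends c to d and d to c^-1.  So this subgroup is normal, although
    <tau, Delta> itself is not. *)
Lemma conjugates_generated (g : G) :
  [/\ H (g * c * g^-1), H (g * d * g^-1) & H (g * t ^+ 2 * g^-1)].
Proof.
have cj (x y z : G) : x * (y * z) * x^-1 = (x * y * x^-1) * (x * z * x^-1).
  by rewrite !mulgA mulgVK.
have cV (x y : G) : x * y^-1 * x^-1 = (x * y * x^-1)^-1.
  by rewrite !invgM invgK mulgA.
have cM (x y z : G) : x * y * z * (x * y)^-1 = x * (y * z * y^-1) * x^-1.
  by rewrite invgM !mulgA.
have HM := generated_M G t D; have HV := generated_V G t D.
have Ht : H t by exact: generated_x.
have Ht2 : H (t ^+ 2) by rewrite expg2; exact: HM.
have Hc : H c.
  have -> : c = t ^+ 2 * D^-1 by rewrite tau2E mulgK.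
  by apply: HM => //; apply/HV/generated_y.
have Hd : H d.
  by rewrite dE; apply: (HM) (HV _ Ht); exact: HM Ht Hc.
elim/gen_ind: g => [|g [Hgc Hgd Hgt]]; first by rewrite invg1 !mulg1 !mul1g.
have tt : t * t ^+ 2 * t^-1 = t ^+ 2 by rewrite -expgS expgSr mulgK.
split; split; rewrite cM ?invgK.
- by rewrite conj_sigma1_c.
- by rewrite conj_sigma1_d cj cV; apply: HM => //; apply: HV.
- by rewrite conj_sigma1_tau2 cj; apply: HM.
- by rewrite -[X in s1^-1 * X * s1]conj_sigma1_c !mulgA !mulgVK.
- have -> : s1^-1 * d * s1 = d * c.
    apply: (mulgI s1); apply: (mulIg s1^-1).
    rewrite !mulgA mulgV mul1g mulgK -[s1 * d * c]mulgA cj.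
    by rewrite conj_sigma1_d conj_sigma1_c mulgVK.
  by rewrite cj; apply: HM.
- have -> : s1^-1 * t ^+ 2 * s1 = c^-1 * t ^+ 2.
    have := conj_sigma1_tau2; move: (t ^+ 2) => u Eu.
    apply: (mulgI s1); apply: (mulIg s1^-1).
    rewrite !mulgA mulgV mul1g mulgK -[s1 * c^-1 * _]mulgA cj.
    by rewrite Eu cV conj_sigma1_c mulKg.
  by rewrite cj cV; apply: HM => //; apply: HV.
- by rewrite -dE.
- by rewrite conj_tau_d cV; apply: HV.
- by rewrite tt.
- have -> : t^-1 * c * t = d^-1.
    apply: invg_inj.
    by rewrite !invgM !invgK -conj_tau_d !mulgA mulgVK mulVg mul1g.
  by rewrite cV; apply: HV.
- by rewrite dE !mulgA !mulgVK.
- by rewrite expg2 mulKg -expg2.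
Qed.

Definition core (n : G) : Prop := forall g, H (g * n * g^-1).

Lemma coreV (n : G) : core n -> core n^-1.
Proof.
by move=> Cn g; have /generated_V := Cn g; rewrite !invgM invgK mulgA.
Qed.

(** In PSL_2(Z) every element is, up to powers of the order-two generator on
    both sides, a product of the unipotents [1 0; 1 1] and [1 1; 0 1].  The
    proof carries this out in B_4 itself: the set of products h m tau^e is
    stable under right multiplication by sigma_1, tau and their inverses,
    because elements of the core can be moved to the far left. *)
Lemma positive_decomposition (g : G) : exists (h m : G) (e : bool),
  [/\ H h, submonoid G s1 s2^-1 m & g = h * m * t ^+ e].
Proof.
have HM := generated_M G t D; have HV := generated_V G t D.
have Ht := generated_x G t D.
have Cc : core c by move=> x; case: (conjugates_generated x).
have Cd : core d by move=> x; case: (conjugates_generated x).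
have Ct2 : core (t ^+ 2) by move=> x; case: (conjugates_generated x).
pose P g := exists (h m : G) (e : bool),
  [/\ H h, submonoid G s1 s2^-1 m & g = h * m * t ^+ e].
have PH h x : H h -> P x -> P (h * x).
  move=> Hh [h' [m [e [Hh' Mm ->]]]]; exists (h * h'), m, e.
  by split => //; [exact: HM | rewrite !mulgA].
have Pm m : submonoid G s1 s2^-1 m -> P m.
  by exists 1, m, false; rewrite mul1g mulg1; split => //; exact: generated_1.
have Pmt m : submonoid G s1 s2^-1 m -> P (m * t).
  by exists 1, m, true; rewrite mul1g; split => //; exact: generated_1.
have Pcore m n x : core n -> P (m * x) -> P (m * (n * x)).
  by move=> Cn /(PH _ _ (Cn m)); rewrite !mulgA mulgVK.
have ts1V : t * s1^-1 = s2^-1 * t.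
  by apply: (mulgI s2); apply: (mulIg s1); rewrite mulVKg -!mulgA mulVg mulg1
    -tau_sigma1.
(* A generator of the monoid followed by the inverse of the other one is,
   up to the core, one generator followed by tau. *)
have sd : s1 * s2 = d * (s2^-1 * t).
  by rewrite -ts1V mulgA d_tau mulgK.
have sdV : s2^-1 * s1^-1 = s1 * (c^-1 * (t ^- 2 * t)).
  rewrite expg2 invgM mulgVK; apply: (mulIg (s1 * s2 * s1)).
  rewrite -{2}d_tau dE mulgVK -!mulgA mulKg mulKg.
  by rewrite [t^-1 * _]mulKg mulVg mulg1.
have Pmtt m : submonoid G s1 s2^-1 m -> P (m * t ^+ 2).
  move=> Mm; rewrite -[t ^+ 2]mulg1; apply: Pcore => //.
  by rewrite mulg1; apply: Pm.
have Ps2 m : submonoid G s1 s2^-1 m -> P (m * (s2 * t)).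
  case=> [|m' Mm'|m' Mm'].
  - rewrite mul1g -tau_sigma1; apply: PH => //; apply: Pm.
    by rewrite -[X in submonoid _ _ _ X]mul1g; apply/submonoid_x/submonoid_1.
  - rewrite -mulgA [s1 * _]mulgA sd -mulgA; apply: Pcore => //.
    by rewrite -mulgA -expg2 mulgA; apply: Pmtt; apply: submonoid_y.
  - by rewrite -mulgA mulKg; apply: Pmt.
have Ps1V m : submonoid G s1 s2^-1 m -> P (m * s1^-1).
  case=> [|m' Mm'|m' Mm'].
  - rewrite mul1g -[s1^-1](mulKg t) ts1V; apply: PH; first exact: HV.
    apply: Pmt; rewrite -[X in submonoid _ _ _ X]mul1g.
    exact/submonoid_y/submonoid_1.
  - by rewrite mulgK; apply: Pm.
  - rewrite -mulgA sdV [m' * _]mulgA.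
    apply: (Pcore); first exact: coreV.
    by apply: Pcore; [exact: coreV | exact/Pmt/submonoid_x].
have step m (e : bool) : submonoid G s1 s2^-1 m ->
    [/\ P (m * (t ^+ e * s1)), P (m * (t ^+ e * s1^-1)),
        P (m * (t ^+ e * t)) & P (m * (t ^+ e * t^-1))].
  move=> Mm; case: e; rewrite ?expg1 ?mul1g; split.
  - by rewrite tau_sigma1; apply: Ps2.
  - by rewrite ts1V mulgA; apply/Pmt/submonoid_y.
  - by rewrite -expg2; apply: Pmtt.
  - by rewrite mulgV mulg1; apply: Pm.
  - exact/Pm/submonoid_x.
  - exact: Ps1V.
  - exact: Pmt.
  - have -> : t^-1 = t ^- 2 * t by rewrite expg2 invgM mulgVK.
    by apply: Pcore; [exact: coreV | exact: Pmt].
elim/gen_ind: g => [|g]; first by apply: Pm; exact: submonoid_1.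
rewrite -/(P g) => -[h [m [e [Hh Mm ->]]]].
have [P1 P2 P3 P4] := step m e Mm.
by split; rewrite -!mulgA; exact: PH.
Qed.

End FourStrandRelations.

Lemma braid_classM (u v : word) :
  (braid_class u * braid_class v)%g = braid_class (u ++ v).
Proof. exact: B4_mulE. Qed.

Lemma sigma_121 : (sigma1 * sigma2 * sigma1 = sigma2 * sigma1 * sigma2)%g.
Proof.
by rewrite /sigma1 /sigma2 !braid_classM; apply/braid_classP; exact: braid_121.
Qed.

Lemma sigma_232 : (sigma2 * sigma3 * sigma2 = sigma3 * sigma2 * sigma3)%g.
Proof.
by rewrite /sigma2 /sigma3 !braid_classM; apply/braid_classP; exact: braid_232.
Qed.

Lemma sigma_13 : (sigma1 * sigma3 = sigma3 * sigma1)%g.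
Proof.
by rewrite /sigma1 /sigma3 !braid_classM; apply/braid_classP; exact: braid_13.
Qed.

(** Conjugation by tau sends sigma_1 to sigma_2 and sigma_2 to sigma_3. *)
Lemma braid_gen_ind (P : B4 -> Prop) : P 1%g ->
  (forall g, P g -> [/\ P (g * sigma1)%g, P (g * sigma1^-1)%g,
                        P (g * tau)%g & P (g * tau^-1)%g]) ->
  forall g, P g.
Proof.
move=> P1 Pgen.
have Ps1 g : P g -> P (g * sigma1)%g /\ P (g * sigma1^-1)%g.
  by case/Pgen.
have conj x : (forall g, P g -> P (g * x)%g /\ P (g * x^-1)%g) ->
    forall g, P g -> P (g * (tau * x * tau^-1))%g /\
                     P (g * (tau * x * tau^-1)^-1)%g.
  have key y g : P (g * tau * y)%g -> P (g * (tau * y * tau^-1))%g.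
    by case/Pgen=> _ _ _; rewrite -(mulgA g tau) -mulgA.
  move=> Px g /Pgen[_ _ /Px[A B] _]; split; first exact: key.
  have -> : ((tau * x * tau^-1)^-1 = tau * x^-1 * tau^-1)%g; last exact: key.
  by rewrite (invgM _ tau^-1%g) (invgM tau) invgK (mulgA tau).
have Ps2 : forall g, P g -> P (g * sigma2)%g /\ P (g * sigma2^-1)%g.
  have -> : sigma2 = (tau * sigma1 * tau^-1)%g.
    by rewrite (tau_sigma1 _ _ _ _ _ sigma_121 sigma_13 erefl) mulgK.
  exact: conj.
have Ps3 : forall g, P g -> P (g * sigma3)%g /\ P (g * sigma3^-1)%g.
  have -> : sigma3 = (tau * sigma2 * tau^-1)%g.
    by rewrite (tau_sigma2 _ _ _ _ _ sigma_232 sigma_13 erefl) mulgK.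
  exact: conj.
have inv i : (braid_class [:: (i, true)])^-1%g = braid_class [:: (i, false)].
  apply: (mulgI (braid_class [:: (i, true)])); rewrite mulgV braid_classM.
  by apply/esym/braid_classP; exact: (braid_cancel (i, true)).
move=> g; rewrite -[g]braid_class_repr; elim/last_ind: (repr g) => [|u l IH] //.
rewrite -cats1 -braid_classM.
case: l => -[[|[|[|//]]] lt3] b.
- have -> : Ordinal lt3 = @Ordinal 3 0 isT by apply: val_inj.
  by have [? ?] := Ps1 _ IH; case: b; rewrite -?inv.
- have -> : Ordinal lt3 = @Ordinal 3 1 isT by apply: val_inj.
  by have [? ?] := Ps2 _ IH; case: b; rewrite -?inv.
- have -> : Ordinal lt3 = @Ordinal 3 2 isT by apply: val_inj.
  by have [? ?] := Ps3 _ IH; case: b; rewrite -?inv.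
Qed.

(** * Alternating words in a group with x^4 = y^2 *)

Section AlternatingWords.
Local Open Scope group_scope.
Variables (G : groupType) (x y : G).
Hypothesis x4y2 : x ^+ 4 = y ^+ 2.

Definition alternating (s : seq nat) : G := y * \prod_(i <- s) (x ^+ i * y).

Lemma alternating_nil : alternating [::] = y.
Proof. by rewrite /alternating big_nil mulg1. Qed.

Lemma alternating_rcons (s : seq nat) (i : nat) :
  alternating (rcons s i) = alternating s * x ^+ i * y.
Proof. by rewrite /alternating -cats1 big_cat big_seq1 /= !mulgA. Qed.

Lemma alternating_cons (s : seq nat) (i : nat) :
  alternating (i :: s) = y * x ^+ i * alternating s.
Proof. by rewrite /alternating big_cons /= !mulgA. Qed.

Lemma commute_x4 (n : nat) : commute y (x ^+ (4 * n)).
Proof.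
by apply: commute_sym; rewrite expgnA x4y2 -expgnA;
  apply: commute_sym; exact: commuteX.
Qed.

Lemma commute_x4_alternating (n : nat) (s : seq nat) (k : nat) :
  commute (x ^+ (4 * n)) (alternating s * x ^+ k).
Proof.
apply: commuteM; last exact: commuteX2.
elim/last_ind: s => [|s i IH].
  by rewrite alternating_nil; exact/commute_sym/commute_x4.
rewrite alternating_rcons; apply: commuteM; last exact/commute_sym/commute_x4.
by apply: commuteM => //; exact: commuteX2.
Qed.

Definition reduced (s : seq nat) : bool := all (fun i => 1 <= i <= 3)%N s.

Definition alternating_form (w : G) : Prop :=
  (exists j, w = x ^+ j) \/
  (exists j s e, reduced s /\ w = x ^+ j * alternating s * x ^+ e).

Lemma alternating_formX (w : G) (n : nat) :
  alternating_form w -> alternating_form (w * x ^+ n).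
Proof.
case=> [[j ->]|[j [s [e [rs ->]]]]].
  by left; exists (j + n)%N; rewrite expgnDr.
by right; exists j, s, (e + n)%N; rewrite expgnDr !mulgA.
Qed.

Lemma alternating_formY (w : G) :
  alternating_form w -> alternating_form (w * y).
Proof.
case=> [[j ->]|[j [s [e [rs ->]]]]].
  by right; exists j, [::], 0; rewrite alternating_nil mulg1.
have [r0|r_gt0] := posnP (e %% 4)%N.
- have -> : e = (4 * (e %/ 4))%N by rewrite mulnC [LHS](divn_eq e 4) r0 addn0.
  move: (e %/ 4)%N => a.
  rewrite -mulgA -commute_x4 mulgA.
  case/lastP: s rs => [|s i] rs.
    left; exists (j + 4 + 4 * a)%N.
    by rewrite alternating_nil -[_ * y * y]mulgA -expg2 -x4y2 !expgnDr.
  right; exists j, s, (i + 4 + 4 * a)%N; split.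
    by move: rs; rewrite /reduced all_rcons => /andP[].
  rewrite alternating_rcons !mulgA -[_ * y * y]mulgA -expg2 -x4y2.
  by rewrite !expgnDr !mulgA.
- right; exists j, (rcons s (e %% 4)%N), (4 * (e %/ 4))%N; split.
    rewrite /reduced all_rcons r_gt0 /=; apply/andP; split=> //.
    by rewrite -ltnS ltn_mod.
  rewrite alternating_rcons -!mulgA; do 3!congr (_ * _).
  by rewrite commute_x4 mulgA -expgnDr addnC mulnC -divn_eq.
Qed.

(** Inverses cost a power of x^4: x^-1 = x^3 x^-4 and y^-1 = y x^-4, and x^4 is
    central in <x, y>.  The shift by x^(4p) keeps all exponents natural. *)
Lemma generated_alternating_form (g : G) :
  generated G x y g -> exists p, alternating_form (g * x ^+ (4 * p)).
Proof.
pose P g := exists p, alternating_form (g * x ^+ (4 * p)).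
(* Both signs together let the induction pass through inverses. *)
suff : forall g, generated G x y g ->
    forall h, P h -> P (h * g) /\ P (h * g^-1).
  move=> /[apply] /(_ 1) [|]; last by rewrite mul1g.
  by exists 0; left; exists 0; rewrite muln0 mulg1.
move=> {}g; elim=> {g} [|||g1 g2 _ IH1 _ IH2|g _ IH] h Ph.
- by rewrite invg1 mulg1.
- case: Ph => p Fp; split.
    exists p; rewrite -mulgA -expgS expgSr mulgA -[X in _ * X]expg1.
    exact: alternating_formX.
  have xV : x^-1 * x ^+ (4 * p.+1) = x ^+ (4 * p) * x ^+ 3.
    by rewrite mulnS (expgS x (3 + 4 * p)) mulKg addnC expgnDr.
  by exists p.+1; rewrite -mulgA xV mulgA; exact: alternating_formX.
- case: Ph => p Fp; split.
    exists p; rewrite -mulgA commute_x4 mulgA; exact: alternating_formY.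
  have yV : y^-1 * x ^+ (4 * p.+1) = x ^+ (4 * p) * y.
    by rewrite mulnS expgnDr x4y2 expg2 -mulgA mulKg commute_x4.
  by exists p.+1; rewrite -mulgA yV mulgA; exact: alternating_formY.
- have [Ph1 _] := IH1 _ Ph; have [P2 _] := IH2 _ Ph1.
  have [_ Q2] := IH2 _ Ph; have [_ Q1] := IH1 _ Q2.
  by rewrite invgM !mulgA.
- by rewrite invgK; have [] := IH _ Ph.
Qed.

Hypothesis x_free : forall a b, x ^+ a = x ^+ b -> a = b.
Hypothesis alternating_neq : forall s a b, s != [::] -> reduced s ->
  x ^+ (4 * a) * alternating s <> x ^+ (4 * b).

(** If x^j w x^e is a power of x^4 then w is x^-r up to powers of x^4, where
    r = j + e modulo 4.  If r = 0 then w itself is a power of x^4; it is not the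
    word y, for otherwise y = x^(4b) and x^4 = y^2 = x^(8b), against
    torsion-freeness.  If r <> 0, choose f, f' in {1, 2, 3} with f + f' = r
    modulo 4: then y x^f w x^f' y is a power of x^4. *)
Lemma alternating_form_neq (j e p : nat) (s : seq nat) : reduced s ->
  x ^+ j * alternating s * x ^+ e <> x ^+ (4 * p).
Proof.
move=> rs E.
have {E} : alternating s * x ^+ (e + j) = x ^+ (4 * p).
  apply: (mulgI (x ^+ j)).
  transitivity (x ^+ j * alternating s * x ^+ e * x ^+ j).
    by rewrite expgnDr !mulgA.
  by rewrite E -!expgnDr addnC.
set n := (e + j)%N; rewrite (divn_eq n 4) addnC mulnC expgnDr.
move: (n %/ 4)%N (ltn_pmod n (isT : 0 < 4)%N) => a; move: (n %% 4)%N => r r4.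
have cz k u v := commute_x4_alternating u v k.
rewrite mulgA => E.
have key f f' eps : (f + f' = r + 4 * eps)%N -> reduced [:: f; f'] -> False.
  move=> ff' rff.
  apply: (alternating_neq (f :: rcons s f') a (p + eps).+1) => //.
    by move: rff rs; rewrite /reduced /= all_rcons andbT => /andP[-> ->] ->.
  rewrite alternating_cons alternating_rcons.
  have U : x ^+ f * (alternating s * x ^+ f' * x ^+ (4 * a)) =
           x ^+ (4 * (p + eps)).
    apply: (mulIg (x ^+ r)).
    transitivity (x ^+ f * (alternating s * x ^+ r * x ^+ (4 * a)) * x ^+ f').
      move: (alternating s) => A; rewrite -!(mulgA A) -!expgnDr.
      rewrite -[LHS]mulgA -[RHS]mulgA -!(mulgA A) -!expgnDr.
      by rewrite addnAC [in RHS]addnAC [in RHS](addnC r).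
    rewrite E -!expgnDr; congr (x ^+ _).
    by rewrite addnAC ff' mulnDr -[LHS]addnA [LHS]addnC (addnC (4 * eps)%N).
  have -> : x ^+ (4 * a) * (y * x ^+ f * (alternating s * x ^+ f' * y)) =
     y * (x ^+ f * (alternating s * x ^+ f' * x ^+ (4 * a))) * y.
    move: (cz f' a s) (commute_x4 a) (commuteX2 (4 * a) f (commute_refl x)).
    rewrite /commute; move: (alternating s) (x ^+ (4 * a)) (x ^+ f) (x ^+ f').
    move=> A z u v zA zy zu; rewrite -!mulgA (mulgA z y) -zy -mulgA.
    congr (_ * _); rewrite (mulgA z u) zu -(mulgA u z); congr (_ * _).
    by rewrite (mulgA A v y) (mulgA z) zA -!mulgA zy.
  by rewrite U commute_x4 -mulgA -expg2 -x4y2 -expgnDr mulnS addnC.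
case: r r4 E key => [|[|[|[|//]]]] _ E key.
- rewrite mulg1 in E.
  have [s0|s0] := eqVneq s [::]; last first.
    apply: (alternating_neq s a p) => //.
    by have := cz 0 a s; rewrite mulg1 => ->.
  move: E; rewrite s0 alternating_nil => E.
  have : x ^+ (4 + 8 * a) = x ^+ (8 * p).
    have -> : (8 * p = (4 * p) * 2)%N by rewrite mulnAC.
    rewrite [RHS]expgnA -E expgMn; last exact: commute_x4.
    rewrite expgnDr x4y2 -expgnA; congr (_ * x ^+ _).
    by rewrite mulnAC.
  by move/x_free/(congr1 (modn^~ 8%N)); rewrite /= addnC mulnC modnMDl modnMr.
- exact: (key 2 3 1 erefl isT)%N.
- exact: (key 1 1 0 erefl isT)%N.
- exact: (key 1 2 0 erefl isT)%N.
Qed.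

End AlternatingWords.

(** * Two by two matrices *)

Section Mx2.

Definition mx2 {R : Type} (a b c d : R) : 'M[R]_2 :=
  \matrix_(i, j) if val i == 0%N then (if val j == 0%N then a else b)
                 else if val j == 0%N then c else d.

Lemma mx2M (R : pzRingType) (a b c d a' b' c' d' : R) :
  mx2 a b c d *m mx2 a' b' c' d' =
  mx2 (a * a' + b * c') (a * b' + b * d') (c * a' + d * c') (c * b' + d * d').
Proof.
apply/matrixP=> -[[|[|//]] ?] [[|[|//]] ?];
by rewrite !(mxE, big_ord_recl, big_ord0) /= addr0.
Qed.

Lemma mx2_scalar (R : pzRingType) (a : R) : a%:M = mx2 a 0 0 a.
Proof. by apply/matrixP=> -[[|[|//]] ?] [[|[|//]] ?]; rewrite !mxE. Qed.

Lemma mx2E (R : Type) (A : 'M[R]_2) : A = mx2 (A 0 0) (A 0 1) (A 1 0) (A 1 1).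
Proof.
by apply/matrixP=> -[[|[|//]] ?] [[|[|//]] ?]; rewrite mxE /=;
  congr (A _ _); apply: val_inj.
Qed.

Definition posmx (R : numDomainType) (A : 'M[R]_2) : bool :=
  [&& 0 < A 0 0, 0 <= A 0 1, 0 <= A 1 0 & 0 < A 1 1].

Lemma posmx1 (R : numDomainType) : posmx R 1%:M.
Proof. by rewrite /posmx !mxE /= lexx ltr01. Qed.

Lemma posmxM (R : numDomainType) (A B : 'M[R]_2) :
  posmx R A -> posmx R B -> posmx R (A *m B).
Proof.
case/and4P=> a b c d /and4P[a' b' c' d'].
have mE i j : (A *m B) i j = A i 0 * B 0 j + A i 1 * B 1 j.
  rewrite mxE !big_ord_recl big_ord0 addr0.
  by congr (A _ _ * B _ _ + A _ _ * B _ _); apply: val_inj.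
apply/and4P; split; rewrite mE.
- by rewrite ltr_wpDr ?mulr_ge0 ?mulr_gt0.
- by rewrite addr_ge0 ?mulr_ge0 // ltW.
- by rewrite addr_ge0 ?mulr_ge0 // ltW.
- by rewrite ltr_wpDl ?mulr_ge0 ?mulr_gt0.
Qed.

End Mx2.

(** * The action of braids on pairs of group elements *)

Section PairAction.
Local Open Scope group_scope.
Variable G : groupType.

(** B_4 acts by conjugation on the free group on c and d; a pair (x, y) is a
    homomorphism from this free group to G, and a braid acts by precomposition.
    This is a right action. *)
Definition pair_letter (q : G * G) (l : letter) : G * G :=
  let: (x, y) := q in
  match val l.1, l.2 with
  | 0, true => (x, y * x^-1) | 0, false => (x, y * x)
  | 1, true => (y * x, y)    | 1, false => (y^-1 * x, y)
  | _, true => (x, x^-1 * y) | _, false => (x, x * y)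
  end.

Definition pair_word (q : G * G) (u : word) : G * G := foldl pair_letter q u.

Lemma pair_word_braid (u v : word) :
  braid_eq u v -> forall q, pair_word q u = pair_word q v.
Proof.
elim=> {u v} //=.
- by move=> v u w _ IH1 _ IH2 q; rewrite IH1.
- move=> u u' v v' _ IH1 _ IH2 q.
  by rewrite /pair_word !foldl_cat -!/(pair_word _ _) IH1 IH2.
- by move=> [[[|[|[|//]]] ?] []] [x y]; rewrite /pair_word /pair_letter /=
    ?mulgK ?mulgVK ?mulKg ?mulVKg.
- move=> [x y]; rewrite /pair_word /pair_letter /=.
  by rewrite !mulgVK invgM !mulgA.
- move=> [x y]; rewrite /pair_word /pair_letter /=.
  by rewrite !invgM !mulgA !mulgVK.
- by move=> [x y]; rewrite /pair_word /pair_letter /= !mulgA.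
Qed.

Definition pair_act (q : G * G) (b : B4) : G * G := pair_word q (repr b).

Lemma pair_act_class (q : G * G) (u : word) :
  pair_act q (braid_class u) = pair_word q u.
Proof. exact/pair_word_braid/braid_repr. Qed.

Lemma pair_actM (q : G * G) (a b : B4) :
  pair_act q (a * b) = pair_act (pair_act q a) b.
Proof. by rewrite [a * b]/(B4_mul a b) pair_act_class /pair_word foldl_cat. Qed.

Definition conj_pair (g : G) (q : G * G) : G * G :=
  (g * q.1 * g^-1, g * q.2 * g^-1).

Lemma conj_pairM (g h : G) (q : G * G) :
  conj_pair (g * h) q = conj_pair g (conj_pair h q).
Proof. by rewrite /conj_pair /= !invgM !mulgA. Qed.

Lemma conj_pair_act (g : G) (q : G * G) (b : B4) :
  pair_act (conj_pair g q) b = conj_pair g (pair_act q b).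
Proof.
rewrite /pair_act; elim: (repr b) q => [|l u IH] q //=; rewrite -IH.
have cM x y : g * x * g^-1 * (g * y * g^-1) = g * (x * y) * g^-1.
  by rewrite !mulgA mulgVK.
have cV x : (g * x * g^-1)^-1 = g * x^-1 * g^-1.
  by rewrite !invgM invgK mulgA.
congr pair_word; case: q => x y; rewrite /pair_letter /conj_pair /=.
by case: l => -[[|[|[|//]]] ?] [] /=; rewrite ?cV ?cM.
Qed.

Lemma pair_act_tau (x y : G) : pair_act (x, y) tau = (y, x^-1).
Proof.
rewrite !pair_actM !pair_act_class /pair_word /pair_letter /=.
by rewrite mulgVK !mulgA mulVg mul1g.
Qed.

Lemma pair_act_Delta (x y : G) :
  pair_act (x, y) Delta = (x^-1, x^-1 * y^-1 * x).
Proof.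
rewrite /Delta -/tau 2!pair_actM [pair_act _ (tau * _)]pair_actM pair_act_tau.
rewrite !pair_act_class /pair_word /pair_letter /=.
by rewrite mulgVK invgK.
Qed.

Variables (x y : G).
Hypothesis x4y2 : x ^+ 4 = y ^+ 2.
(* The values that c and d must take, by c = tau^2 Delta^-1 and
   d = tau c tau^-1, when tau and Delta are sent to x and y. *)
Let c := x ^+ 2 * y^-1.
Let q := (c, x * c * x^-1).

Definition tracks (b : B4) (g : G) : Prop := pair_act q b = conj_pair g q.

(** The order of the factors is kept although the action is on the right:
    conjugation commutes with the action, so the conjugation produced by the
    first factor stays outermost. *)
Lemma tracksM (b b' : B4) (g g' : G) :
  tracks b g -> tracks b' g' -> tracks (b * b') (g * g').
Proof.
by rewrite /tracks => Eb Eb'; rewrite pair_actM Eb conj_pair_act Eb' conj_pairM.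
Qed.

Lemma tracks_tau : tracks tau x.
Proof.
rewrite /tracks /q pair_act_tau /conj_pair; congr (_, _) => /=.
transitivity (x ^+ 4 * y^-1 * (x ^+ 2)^-1).
  by rewrite x4y2 expg2 mulgK /c invgM invgK.
by rewrite /c (expgnDr x 2 2) expg2 invgM !mulgA.
Qed.

Lemma tracks_Delta : tracks Delta y.
Proof.
have yV2 : y^-1 * y^-1 = x ^- 2 * x ^- 2.
  by rewrite -!invgM -expg2 -x4y2 (expgnDr x 2 2).
have xc : x * c = x^-1 * y.
  apply: (mulgI x); rewrite mulVKg; transitivity (x ^+ 4 * y^-1).
    by rewrite /c (expgnDr x 2 2) expg2 !mulgA.
  by rewrite x4y2 expg2 mulgK.
have yxy : y^-1 * x^-1 * y = y * x^-1 * y^-1.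
  have xy2 : x^-1 * y ^+ 2 = y ^+ 2 * x^-1.
    rewrite -x4y2; exact/commute_sym/commuteV/commute_sym/commuteX.
  apply: (mulIg y); apply: (mulgI y).
  by rewrite -!mulgA -expg2 mulVKg xy2 mulVg mulg1 expg2 mulgA.
have cV : c^-1 = y * x ^- 2 by rewrite /c invgM invgK.
rewrite /tracks /q pair_act_Delta /conj_pair; congr (_, _) => /=.
  by rewrite cV /c -[RHS]mulgA -[x ^+ 2 * _ * _]mulgA yV2 (mulVKg (x ^+ 2)).
rewrite xc cV !invgM !invgK.
move: (c) xc => e xe; rewrite -!mulgA mulKg xe.
rewrite !mulgA -[y * x^-1 * y^-1 * _ * _]mulgA -[y * x^-1 * _ * _]mulgA.
by rewrite (mulgA y^-1) yxy !mulgA.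
Qed.

Lemma tracksX (b : B4) (g : G) (n : nat) :
  tracks b g -> tracks (b ^+ n) (g ^+ n).
Proof.
move=> Tb; elim: n => [|n IH]; last by rewrite !expgS; exact: tracksM.
by rewrite /tracks pair_act_class /conj_pair !mul1g invg1 !mulg1.
Qed.

Lemma tracks_alternating (s : seq nat) :
  tracks (alternating B4 tau Delta s) (alternating G x y s).
Proof.
elim/last_ind: s => [|s i IH].
  by rewrite !alternating_nil; exact: tracks_Delta.
rewrite !alternating_rcons; apply: tracksM tracks_Delta.
by apply: tracksM => //; apply: tracksX; exact: tracks_tau.
Qed.

End PairAction.

(** * The group of units of a ring *)

Section UnitGroup.
Variable R : unitRingType.

Record unit_group : Type := UnitGroup {
  unit_val :> R;
  unit_valP : unit_val \is a GRing.unit }.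

HB.instance Definition _ := [isSub for unit_val].
HB.instance Definition _ := [Choice of unit_group by <:].

Lemma unit_val_inj : injective unit_val.
Proof. exact: val_inj. Qed.

Definition unit_group_one : unit_group := UnitGroup 1 (unitr1 R).
Definition unit_group_mul (a b : unit_group) : unit_group :=
  UnitGroup (unit_val a * unit_val b)
    (introT idP (etrans (unitrMl _ (unit_valP b)) (unit_valP a))).
Definition unit_group_inv (a : unit_group) : unit_group :=
  UnitGroup (unit_val a)^-1 (etrans (unitrV _) (unit_valP a)).

Lemma unit_group_mulA : associative unit_group_mul.
Proof. by move=> a b c; apply: val_inj; exact: mulrA. Qed.
Lemma unit_group_mul1 : left_id unit_group_one unit_group_mul.
Proof. by move=> a; apply: val_inj; exact: mul1r. Qed.
Lemma unit_group_mulr1 : right_id unit_group_one unit_group_mul.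
Proof. by move=> a; apply: val_inj; exact: mulr1. Qed.
Lemma unit_group_mulV :
  left_inverse unit_group_one unit_group_inv unit_group_mul.
Proof. by move=> a; apply: val_inj; exact: mulVr (unit_valP a). Qed.
Lemma unit_group_mulrV :
  right_inverse unit_group_one unit_group_inv unit_group_mul.
Proof. by move=> a; apply: val_inj; exact: mulrV (unit_valP a). Qed.

HB.instance Definition _ := isGroup.Build unit_group unit_group_mulA
  unit_group_mul1 unit_group_mulr1 unit_group_mulV unit_group_mulrV.

Lemma unit_valM (a b : unit_group) :
  unit_val (a * b)%g = unit_val a * unit_val b.
Proof. by []. Qed.

Lemma unit_valX (a : unit_group) (n : nat) :
  unit_val (a ^+ n)%g = unit_val a ^+ n.
Proof. by elim: n => [|n IH] //; rewrite exprS expgS unit_valM IH. Qed.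

End UnitGroup.

(** * Alternating words in tau and Delta are not central *)

Lemma det_mx2 (R : comPzRingType) (a b c d : R) :
  \det (mx2 a b c d) = a * d - b * c.
Proof.
rewrite (expand_det_row _ ord0) !big_ord_recl big_ord0 /cofactor !det_mx11.
by rewrite !mxE /= !expr0 expr1; ring.
Qed.

Lemma mx2_unit (a b c d : rat) :
  a * d - b * c != 0 -> mx2 a b c d \is a GRing.unit.
Proof.
suff -> : mx2 a b c d \in unitmx = (\det (mx2 a b c d) != 0).
  by rewrite det_mx2.
by rewrite unitmxE unitfE.
Qed.

(** Modulo scalars these generate the Hecke triangle group with signature
    (2, 4, infinity); the scaling makes T^4 = D^2 = -4 over the rationals.  In
    this basis D T, D T^2 and D T^3 all have nonnegative entries. *)
Definition hecke_T_mx : 'M[rat]_2 := mx2 0 (-2) 1 2.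
Definition hecke_D_mx : 'M[rat]_2 := mx2 0 2 (-2) 0.

Definition hecke_T : unit_group 'M[rat]_2 :=
  UnitGroup _ hecke_T_mx (mx2_unit 0 (-2) 1 2 isT).
Definition hecke_D : unit_group 'M[rat]_2 :=
  UnitGroup _ hecke_D_mx (mx2_unit 0 2 (-2) 0 isT).

Lemma hecke_T2 : hecke_T_mx ^+ 2 = mx2 (-2) (-4) 2 2.
Proof. by rewrite expr2 [_ * _]mx2M; congr mx2. Qed.

Lemma hecke_T4 : hecke_T_mx ^+ 4 = (-4)%:M.
Proof.
by rewrite (exprD _ 2 2) hecke_T2 [_ * _]mx2M mx2_scalar; congr mx2.
Qed.

Lemma hecke_T4D2 : (hecke_T ^+ 4 = hecke_D ^+ 2)%g.
Proof.
apply: unit_val_inj; rewrite !unit_valX hecke_T4 expr2 [RHS]mx2M mx2_scalar.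
by congr mx2.
Qed.

Lemma posmx_DT (i : nat) : (1 <= i <= 3)%N ->
  posmx rat (hecke_D_mx * hecke_T_mx ^+ i).
Proof.
case: i => [|[|[|[|//]]]] // _.
- by rewrite [_ * _]mx2M /posmx !mxE.
- by rewrite hecke_T2 [_ * _]mx2M /posmx !mxE.
- by rewrite exprS hecke_T2 [hecke_T_mx * _]mx2M [_ * _]mx2M /posmx !mxE.
Qed.

Lemma alternating_hecke (s : seq nat) : reduced s ->
  exists2 P : 'M[rat]_2, posmx rat P &
    unit_val _ (alternating _ hecke_T hecke_D s) = P * hecke_D_mx.
Proof.
elim/last_ind: s => [|s i IH] rs.
  by exists 1; [exact: posmx1 | rewrite alternating_nil mul1r].
move: rs; rewrite /reduced all_rcons => /andP[i13 /IH[P posP E]].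
exists (P * (hecke_D_mx * hecke_T_mx ^+ i)).
  by apply: posmxM => //; exact: posmx_DT.
rewrite alternating_rcons unit_valM (unit_valM _ (alternating _ _ _ _)) E.
by rewrite unit_valX !mulrA.
Qed.

Lemma hecke_c : unit_val _ (hecke_T ^+ 2 * hecke_D^-1)%g = mx2 (-2) 1 1 (-1).
Proof.
apply: (mulIr (unit_valP _ hecke_D)).
by rewrite -unit_valM mulgVK unit_valX hecke_T2 [RHS]mx2M; congr mx2.
Qed.

(** If the word were a power of tau^4 then the matrix A of the same word in T
    and D would commute with T^2 D^-1 = [-2 1; 1 -1], as T^4 is scalar.  The
    top left entry of this relation says that A_01 = A_10.  But A = P D with P
    positive on the diagonal, so A_01 = 2 P_00 > 0 > -2 P_11 = A_10. *)
Lemma alternating_braid_neq (s : seq nat) (a b : nat) : reduced s ->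
  (tau ^+ (4 * a) * alternating B4 tau Delta s <> tau ^+ (4 * b))%g.
Proof.
move=> rs E; have [P posP PE] := alternating_hecke s rs.
have tX n := tracksX _ _ _ _ _ n (tracks_tau _ _ _ hecke_T4D2).
have central n g : commute (hecke_T ^+ (4 * n))%g g.
  apply: unit_val_inj; rewrite !unit_valM unit_valX exprM hecke_T4 -rmorphXn.
  exact/esym/scalar_mxC.
have conjz n q : conj_pair _ (hecke_T ^+ (4 * n))%g q = q.
  by case: q => u v; rewrite /conj_pair /= !central !mulgK.
have := tracksM _ _ _ _ _ _ _ (tX (4 * a)%N)
  (tracks_alternating _ _ _ hecke_T4D2 s).
rewrite /tracks E (tX (4 * b)%N) conj_pairM !conjz.
set c := (_ ^+ 2 * _)%g; set A := alternating _ _ _ _ => /(congr1 fst) cA.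
have {cA} : (c * A = A * c)%g.
  have cA' : c = (A * c * A^-1)%g by exact: cA.
  by rewrite {1}cA' mulgVK.
move=> /(congr1 (unit_val _)).
rewrite (unit_valM _ c) (unit_valM _ A) PE hecke_c.
rewrite (mx2E _ P) /hecke_D_mx -!mulmxE !mx2M => /matrixP/(_ 0 0).
by rewrite !mxE /=; case/and4P: posP; lra.
Qed.

(** * Evaluation of Laurent polynomials at -1 *)

Lemma laurent_fraction (x : laurent) : exists pn : {poly int} * nat,
  laurent_val x = FracField.tofrac pn.1 / FracField.tofrac 'X ^+ pn.2.
Proof. by have [p [n E]] := is_laurentP _ (laurent_valP x); exists (p, n). Qed.

(** The factor (-1)^n stands for division by (-1)^n, which is its own inverse,
    so that the values are integers. *)
Definition eval_m1 (x : laurent) : int :=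
  let pn := sval (cid (laurent_fraction x)) in pn.1.[-1] * (-1) ^+ pn.2.

Lemma eval_m1E (x : laurent) (p : {poly int}) (n : nat) :
  laurent_val x = FracField.tofrac p / FracField.tofrac 'X ^+ n ->
  eval_m1 x = p.[-1] * (-1) ^+ n.
Proof.
rewrite /eval_m1; case: cid => -[q m] /= -> /eqP.
rewrite eqr_div ?expf_neq0 ?fracX_neq0 // -!tofracXn -!tofracM tofrac_eq.
move=> /eqP/(congr1 (horner^~ (-1))); rewrite !hornerM !hornerXn => E.
apply: (mulIf (x := (-1) ^+ m * (-1) ^+ n)).
  by rewrite mulf_neq0 ?expf_neq0 // oppr_eq0 oner_eq0.
have s k : (-1) ^+ k * (-1) ^+ k = 1 :> int by rewrite -expr2 sqrr_sign.
rewrite mulrA -[_ * _ * (-1) ^+ m]mulrA s mulr1 E.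
by rewrite mulrCA -!mulrA s mulr1 mulrC.
Qed.

Fact eval_m1_zmod : zmod_morphism eval_m1.
Proof.
move=> x y; have [[p n] /= Ex] := laurent_fraction x.
have [[q m] /= Ey] := laurent_fraction y.
have X0 := fracX_neq0.
rewrite (eval_m1E _ _ _ Ex) (eval_m1E _ _ _ Ey).
rewrite (eval_m1E _ (p * 'X^m - q * 'X^n) (n + m)).
  rewrite hornerD hornerN !hornerM !hornerXn exprD mulrBl.
  have s k : (-1) ^+ k * (-1) ^+ k = 1 :> int by rewrite -expr2 sqrr_sign.
  congr (_ - _); first by rewrite mulrACA s mulr1.
  by rewrite -mulrA (mulrA ((-1) ^+ n)) s mul1r.
have -> : laurent_val (x - y) = laurent_val x - laurent_val y.
  exact: (rmorphB val).
rewrite Ex Ey.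
by rewrite tofracB !tofracM !tofracXn exprD -mulNr addf_div ?expf_neq0 // mulNr.
Qed.

Fact eval_m1_monoid : monoid_morphism eval_m1.
Proof.
split=> [|x y].
  rewrite (eval_m1E _ 1 0) ?hornerC ?mulr1 //.
  by rewrite laurent_val1 tofrac1 expr0 divr1.
have [[p n] /= Ex] := laurent_fraction x.
have [[q m] /= Ey] := laurent_fraction y.
rewrite (eval_m1E _ _ _ Ex) (eval_m1E _ _ _ Ey).
rewrite (eval_m1E _ (p * q) (n + m)); first by rewrite hornerM exprD mulrACA.
by rewrite laurent_valM Ex Ey tofracM exprD mulf_div.
Qed.

HB.instance Definition _ :=
  GRing.isZmodMorphism.Build laurent int eval_m1 eval_m1_zmod.
HB.instance Definition _ :=
  GRing.isMonoidMorphism.Build laurent int eval_m1 eval_m1_monoid.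

Lemma eval_m1X : eval_m1 laurentX = -1.
Proof. by rewrite (eval_m1E _ 'X 0) ?hornerX ?mulr1 // expr0 divr1. Qed.

Lemma laurentX_torsionfree (a b : nat) :
  laurentX ^+ a = laurentX ^+ b -> a = b.
Proof.
have vX n : laurent_val (laurentX ^+ n) = FracField.tofrac 'X^n.
  by rewrite tofracXn; exact: (rmorphXn val).
move=> /(congr1 laurent_val); rewrite !vX => /eqP; rewrite tofrac_eq => /eqP.
by move=> /(congr1 (fun p : {poly int} => size p)); rewrite !size_polyXn => -[].
Qed.

(** * The Burau representation on tau and Delta *)

Lemma rho4_1 : rho4 1%g = 1%g.
Proof. exact: rho4_class. Qed.

Lemma rho4X (g : B4) (n : nat) : rho4 (g ^+ n)%g = (rho4 g ^+ n)%g.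
Proof.
by elim: n => [|n IH]; [exact: rho4_1 | rewrite expgS rho4M IH -expgSr].
Qed.

Lemma rho4V (g : B4) : rho4 g^-1%g = (rho4 g)^-1%g.
Proof.
by apply: (mulgI (rho4 g)); rewrite -rho4M mulVg mulgV; exact: rho4_1.
Qed.

Lemma rho4_injP : (forall g, rho4 g = 1%g -> g = 1%g) -> injective rho4.
Proof.
move=> ker1 g h E; apply/divg1_eq/ker1.
by rewrite rho4M rho4V E mulVg.
Qed.

Lemma rho4_alternating (s : seq nat) :
  rho4 (alternating B4 tau Delta s) =
  alternating _ (rho4 tau) (rho4 Delta) (rev s).
Proof.
elim/last_ind: s => [|s i IH]; first by rewrite !alternating_nil.
rewrite alternating_rcons rev_rcons alternating_cons -IH (rho4M _ Delta).
by rewrite (rho4M _ (tau ^+ i)%g) rho4X (mulgA (rho4 Delta)).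
Qed.

Lemma tau4_Delta2 : (tau ^+ 4 = Delta ^+ 2)%g.
Proof.
have DeltaE : (Delta = tau * (sigma1 * sigma2 * sigma1))%g.
  by rewrite /Delta /tau !mulgA.
exact: (tau4E _ _ _ _ _ _ _ sigma_121 sigma_232 sigma_13 erefl DeltaE erefl).
Qed.

Lemma GL3_val_inj : injective GL3_val.
Proof. exact: val_inj. Qed.

Lemma GL3_valX (A : GL3) (n : nat) : GL3_val (A ^+ n)%g = GL3_val A ^+ n.
Proof. by elim: n => [|n IH] //; rewrite expgS exprS -IH. Qed.

Lemma burau_Delta_sqr (R : comNzRingType) (t : R) :
  (burau1 t *m (burau2 t *m (burau1 t *m
    (burau3 t *m (burau2 t *m burau1 t))))) ^+ 2 = (t ^+ 4)%:M.
Proof.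
have -> : burau1 t *m (burau2 t *m (burau1 t *m
    (burau3 t *m (burau2 t *m burau1 t)))) =
  mx3 [:: [:: 0; 0; - t ^+ 3]; [:: 0; - t ^+ 2; 0]; [:: - t; 0; 0]].
  have -> : burau3 t *m (burau2 t *m burau1 t) =
    mx3 [:: [:: - t; t; 0]; [:: - t; 0; t]; [:: - t; 0; 0]].
    apply/matrixP=> -[[|[|[|//]]] ?] [[|[|[|//]]] ?];
    by rewrite !(mxE, big_ord_recl, big_ord0) /=; ring.
  rewrite !mulmxA.
  have -> : burau1 t *m burau2 t *m burau1 t =
    mx3 [:: [:: 0; - t ^+ 2; t ^+ 2]; [:: - t; 0; t]; [:: 0; 0; 1]].
    apply/matrixP=> -[[|[|[|//]]] ?] [[|[|[|//]]] ?];
    by rewrite !(mxE, big_ord_recl, big_ord0) /=; ring.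
  apply/matrixP=> -[[|[|[|//]]] ?] [[|[|[|//]]] ?];
  by rewrite !(mxE, big_ord_recl, big_ord0) /=; ring.
rewrite expr2 -mulmxE.
apply/matrixP=> -[[|[|[|//]]] ?] [[|[|[|//]]] ?];
by rewrite !(mxE, big_ord_recl, big_ord0) /=; ring.
Qed.

Lemma rho4_tau4 : GL3_val (rho4 tau) ^+ 4 = (laurentX ^+ 4)%:M.
Proof.
rewrite -GL3_valX -rho4X tau4_Delta2 rho4X GL3_valX -burau_Delta_sqr.
by rewrite !rho4M -rho4_sigma1 -rho4_sigma2 -rho4_sigma3.
Qed.

Lemma rho4_tau4X (n : nat) :
  GL3_val (rho4 tau ^+ (4 * n))%g = (laurentX ^+ (4 * n))%:M.
Proof. by rewrite GL3_valX exprM rho4_tau4 -rmorphXn -exprM. Qed.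

Lemma rho4_tau_torsionfree (a b : nat) :
  (rho4 tau ^+ a)%g = (rho4 tau ^+ b)%g -> a = b.
Proof.
move=> E; have : (rho4 tau ^+ (4 * a) = rho4 tau ^+ (4 * b))%g.
  by rewrite ![(4 * _)%N]mulnC !expgnA E.
move=> /(congr1 GL3_val); rewrite !rho4_tau4X => /matrixP/(_ 0 0).
rewrite !mxE eqxx !mulr1n => /laurentX_torsionfree/eqP.
by rewrite eqn_pmul2l // => /eqP.
Qed.

(** * The kernel lies in the subgroup generated by tau and Delta *)

(** At t = -1 the image of every braid fixes the column vector (1, 0, 1).  The
    rows of this matrix are a basis of the row vectors that annihilate it. *)
Definition quotient_mx : 'M[int]_(2, 3) :=
  \matrix_(i, j) nth 0 (nth [::] [:: [:: 0; -1; 0]; [:: 1; 0; -1]] i) j.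

Definition quotient_acts (g : B4) (A : 'M[int]_2) : Prop :=
  quotient_mx *m map_mx eval_m1 (rho4 g) = A *m quotient_mx.

Lemma quotient_acts_1 : quotient_acts 1%g 1%:M.
Proof. by rewrite /quotient_acts rho4_1 map_mx1 mulmx1 mul1mx. Qed.

(** The factors are exchanged because rho_4 reverses products. *)
Lemma quotient_actsM (g h : B4) (A B : 'M[int]_2) :
  quotient_acts g A -> quotient_acts h B -> quotient_acts (g * h)%g (B *m A).
Proof.
rewrite /quotient_acts rho4M map_mxM => Ag Bh.
by rewrite mulmxA Bh -!mulmxA Ag.
Qed.

Lemma quotient_actsV (g : B4) (A B : 'M[int]_2) :
  quotient_acts g A -> B *m A = 1%:M -> quotient_acts g^-1%g B.
Proof.
rewrite /quotient_acts => Ag BA.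
have gV : map_mx eval_m1 (rho4 g) *m map_mx eval_m1 (rho4 g^-1%g) = 1%:M.
  rewrite -map_mxM -[_ *m _]/(GL3_val (_ * _)%g) -rho4M mulVg rho4_1.
  exact: map_mx1.
set M := map_mx _ _.
transitivity (B *m (A *m quotient_mx) *m M); first by rewrite mulmxA BA mul1mx.
by rewrite -Ag -!mulmxA gV mulmx1.
Qed.

Lemma quotient_acts_id (g : B4) (A : 'M[int]_2) :
  quotient_acts g A -> rho4 g = 1%g -> A = 1%:M.
Proof.
rewrite /quotient_acts => + g1; rewrite g1 map_mx1 mulmx1.
pose F : 'M[int]_(3, 2) :=
  \matrix_(i, j) nth 0 (nth [::] [:: [:: 0; 1]; [:: -1; 0]; [:: 0; 0]] i) j.
have EF : quotient_mx *m F = 1%:M.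
  by apply/matrixP=> -[[|[|//]] ?] [[|[|//]] ?];
    rewrite !(mxE, big_ord_recl, big_ord0).
by move=> /(congr1 (mulmx^~ F)); rewrite -mulmxA EF mulmx1.
Qed.

Lemma quotient_acts_sigma :
  [/\ quotient_acts sigma1 (mx2 1 0 1 1), quotient_acts sigma2 (mx2 1 (-1) 0 1)
    & quotient_acts sigma3 (mx2 1 0 1 1)].
Proof.
have e0 : eval_m1 0 = 0 by rewrite rmorph0.
have e1 : eval_m1 1 = 1 by rewrite rmorph1.
have eN : eval_m1 (- laurentX) = 1 by rewrite rmorphN /= eval_m1X opprK.
split; rewrite /quotient_acts ?rho4_sigma1 ?rho4_sigma2 ?rho4_sigma3;
  apply/matrixP=> -[[|[|//]] ?] [[|[|[|//]]] ?];
  by rewrite !(mxE, big_ord_recl, big_ord0) /= ?(e0, e1, eN, eval_m1X).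
Qed.

Definition quarter_turn : 'M[int]_2 := mx2 0 (-1) 1 0.

Lemma quarter_turn2 : quarter_turn ^+ 2 = (-1)%:M.
Proof. by rewrite expr2 -mulmxE mx2M mx2_scalar; congr mx2. Qed.

Lemma quarter_turn4X (n : nat) : quarter_turn ^+ (4 * n) = 1.
Proof.
by rewrite exprM (exprM _ 2 2) quarter_turn2 -rmorphXn sqrrN !expr1n.
Qed.

Lemma quotient_acts_tau : quotient_acts tau quarter_turn.
Proof.
have [Q1 Q2 Q3] := quotient_acts_sigma.
have -> : quarter_turn = mx2 1 0 1 1 *m (mx2 1 (-1) 0 1 *m mx2 1 0 1 1).
  by rewrite !mx2M; congr mx2.
by apply: quotient_actsM => //; exact: quotient_actsM.
Qed.

Lemma quotient_acts_Delta : quotient_acts Delta (quarter_turn ^+ 2).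
Proof.
have [Q1 Q2 Q3] := quotient_acts_sigma.
have -> : quarter_turn ^+ 2 =
    mx2 1 0 1 1 *m (mx2 1 (-1) 0 1 *m (mx2 1 0 1 1 *m quarter_turn)).
  by rewrite expr2 -mulmxE !mx2M; congr mx2.
do 3!apply: quotient_actsM => //; exact: quotient_acts_tau.
Qed.

Lemma quotient_acts_generated (h : B4) : generated B4 tau Delta h ->
  exists n, quotient_acts h (quarter_turn ^+ n).
Proof.
elim=> {h} [|||g h _ [m Qg] _ [n Qh]|g _ [n Qg]].
- by exists 0%N; exact: quotient_acts_1.
- by exists 1%N; exact: quotient_acts_tau.
- by exists 2%N; exact: quotient_acts_Delta.
- by exists (n + m)%N; rewrite exprD; exact: quotient_actsM.
- exists (3 * n)%N; apply: quotient_actsV Qg _.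
  by rewrite mulmxE -exprD -mulSnr quarter_turn4X.
Qed.

(** The two generators act by [1 0; 1 1] and [1 1; 0 1], and multiplying a
    positive matrix by one of them adds a positive diagonal entry to an
    off-diagonal one. *)
Lemma quotient_acts_submonoid (m : B4) : submonoid B4 sigma1 sigma2^-1%g m ->
  exists P, [/\ quotient_acts m P, posmx int P &
                m = 1%g \/ 0 < P 0 1 + P 1 0].
Proof.
have [Q1 Q2 Q3] := quotient_acts_sigma.
have Q2V : quotient_acts sigma2^-1%g (mx2 1 1 0 1).
  apply: quotient_actsV Q2 _.
  by rewrite mx2M mx2_scalar; congr mx2.
elim=> {m} [|m _ [P [QP posP _]]|m _ [P [QP posP _]]].
- by exists 1%:M; split; [exact: quotient_acts_1 | exact: posmx1 | left].
- exists (mx2 1 0 1 1 *m P); split; first exact: quotient_actsM.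
    by apply: posmxM => //; rewrite /posmx !mxE.
  right; move: posP; rewrite [P]mx2E mx2M /posmx !mxE /= => /and4P[]; lra.
- exists (mx2 1 1 0 1 *m P); split; first exact: quotient_actsM.
    by apply: posmxM => //; rewrite /posmx !mxE.
  right; move: posP; rewrite [P]mx2E mx2M /posmx !mxE /= => /and4P[]; lra.
Qed.

Lemma posmx_quarter_turn (n : nat) :
  posmx int (quarter_turn ^+ n) -> quarter_turn ^+ n = 1%:M.
Proof.
rewrite (divn_eq n 4) mulnC exprD quarter_turn4X mul1r.
case: (n %% 4)%N (ltn_pmod n (isT : 0 < 4)%N) => [|[|[|[|//]]]] _ //.
- by rewrite /posmx !mxE.
- by rewrite quarter_turn2 /posmx !mxE.
- by rewrite exprS quarter_turn2 mx2_scalar -mulmxE mx2M /posmx !mxE.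
Qed.

(** For g = h m tau^e in the kernel, m acts by a power of the quarter turn that
    is positive on the diagonal, hence by the identity, whence m = 1. *)
Lemma rho4_ker_generated (g : B4) : rho4 g = 1%g -> generated B4 tau Delta g.
Proof.
move=> g1.
have DeltaE : (Delta = tau * (sigma1 * sigma2 * sigma1))%g.
  by rewrite /Delta /tau !mulgA.
have [h [m [e [Hh Mm gE]]]] :=
  positive_decomposition _ _ _ _ _ _ _ _ sigma_121 sigma_232 sigma_13
    erefl DeltaE erefl erefl braid_gen_ind g.
have [n Qh] := quotient_acts_generated h Hh.
have [P [Qm posP mP]] := quotient_acts_submonoid m Mm.
have He : generated B4 tau Delta (tau ^+ e)%g.
  by case: (e); [exact: generated_x | exact: generated_1].
have [k Qe] := quotient_acts_generated _ He.
have := quotient_actsM _ _ _ _ (quotient_actsM _ _ _ _ Qh Qm) Qe.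
rewrite -gE => /quotient_acts_id/(_ g1) E.
have PE : P = quarter_turn ^+ (3 * k + 3 * n).
  transitivity (quarter_turn ^+ (3 * k) *
      (quarter_turn ^+ k *m (P *m quarter_turn ^+ n)) *
      quarter_turn ^+ (3 * n)).
    rewrite !mulmxE !mulrA -exprD -mulSnr quarter_turn4X mul1r -mulrA -exprD.
    by rewrite -mulSn quarter_turn4X mulr1.
  by rewrite E mulr1 exprD.
case: mP => [m1|]; last first.
  by rewrite PE posmx_quarter_turn -?PE // !mxE.
by rewrite gE m1 mulg1; exact: generated_M.
Qed.

(** * Faithfulness *)

Lemma rho4_inj_on_generated :
  (forall s a b, s != [::] -> reduced s ->
     (rho4 tau ^+ (4 * a) * alternating _ (rho4 tau) (rho4 Delta) s
       <> rho4 tau ^+ (4 * b))%g) ->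
  forall g, generated B4 tau Delta g -> rho4 g = 1%g -> g = 1%g.
Proof.
move=> alt_neq g Hg g1.
have T4 : (rho4 tau ^+ 4 = rho4 Delta ^+ 2)%g by rewrite -!rho4X tau4_Delta2.
have [p [[j E]|[j [s [e [rs E]]]]]] :=
  generated_alternating_form _ _ _ tau4_Delta2 g Hg.
- have := congr1 rho4 E; rewrite rho4M !rho4X g1 mulg1.
  move=> /rho4_tau_torsionfree pj; move: E; rewrite pj => E.
  by apply: (mulIg (tau ^+ j)%g); rewrite E mul1g.
- have := congr1 rho4 E; rewrite (rho4M g) g1 mulg1 rho4M rho4X.
  rewrite (rho4M (tau ^+ j)%g) !rho4X rho4_alternating mulgA => /esym.
  have rrs : reduced (rev s) by rewrite /reduced all_rev.
  have neq := alternating_form_neq _ _ _ T4 rho4_tau_torsionfree alt_neq.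
  by move/(neq _ _ _ _ rrs).
Qed.

Lemma GL3_val_alternating (x y : GL3) (s : seq nat) :
  GL3_val (alternating _ x y s) =
  GL3_val y * \prod_(i <- s) (GL3_val x ^+ i * GL3_val y).
Proof.
rewrite /alternating -[LHS]/(GL3_val y * GL3_val _); congr (_ * _).
rewrite (big_morph GL3_val (id1 := 1) (op1 := *%R)) //.
by apply: eq_bigr => i _; rewrite -GL3_valX.
Qed.

(** T^4 is the scalar t^4, so the outer factors T^2 can be brought together by
    conjugation and absorbed into a power of t^4; splitting the power as
    T^(4a) on one side and T^(4b) on the other avoids negative exponents. *)
Lemma burau_product_group (s : seq nat) :
  let T : 'M[laurent]_3 := rho4 tau in
  let D : 'M[laurent]_3 := rho4 Delta in
  (exists m : int, laurentX ^ (4 * m) *: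
     (T ^+ 2 * D * (\prod_(i <- s) (T ^+ i * D)) * T ^+ 2) = 1%:M) <->
  (exists a b, (rho4 tau ^+ (4 * a) * alternating _ (rho4 tau) (rho4 Delta) s
       = rho4 tau ^+ (4 * b))%g).
Proof.
move=> T D; set x := rho4 tau; set w := alternating _ _ _ _.
have wE : T ^+ 2 * D * (\prod_(i <- s) (T ^+ i * D)) * T ^+ 2 =
    GL3_val (x ^+ 2 * w * x ^+ 2)%g.
  rewrite -[RHS]/(GL3_val (x ^+ 2)%g * GL3_val w * GL3_val (x ^+ 2)%g).
  by rewrite GL3_valX /w GL3_val_alternating !mulrA.
have scaleX n (g : GL3) : GL3_val (x ^+ (4 * n) * g)%g =
    laurentX ^+ (4 * n) *: GL3_val g.
  by rewrite -mul_scalar_mx -rho4_tau4X.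
have sandwich a : (x ^+ (4 * a) * (x ^+ 2 * w * x ^+ 2) =
                   x ^+ 2 * (x ^+ (4 * a) * w) * x ^+ 2)%g.
  have := commuteX2 (4 * a) 2 (commute_refl x); rewrite /commute.
  by move: (x ^+ 2)%g (x ^+ (4 * a))%g (w) => u v w' uv; rewrite !mulgA uv.
have u : laurentX \is a GRing.unit := laurentX_unit.
split=> [[m]|[a [b E]]].
- rewrite wE => E.
  have [a [b mab]] : exists a b : nat,
      laurentX ^ (4 * m) * laurentX ^+ (4 * b) = laurentX ^+ (4 * a).
    case: m {E} => n; first by exists n, 0%N; rewrite mulr1.
    exists 0%N, n.+1; rewrite exprnP -exprzDr // NegzE PoszM -mulrDr addNr.
    by rewrite mulr0 expr0z.
  exists a.+1, b.
  have : (x ^+ (4 * a) * (x ^+ 2 * w * x ^+ 2) = x ^+ (4 * b))%g.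
    apply: GL3_val_inj; rewrite scaleX rho4_tau4X.
    by rewrite -mab mulrC -scalerA E scalemx1.
  rewrite sandwich => F; apply: (mulIg (x ^+ 2)%g).
  transitivity (x ^+ 2 * (x ^+ 2 * (x ^+ (4 * a) * w) * x ^+ 2))%g.
    rewrite mulnS (expgnDr x 4) (expgnDr x 2 2).
    by move: (x ^+ 2)%g (x ^+ (4 * a))%g (w) => u1 v w'; rewrite !mulgA.
  by rewrite F -!expgnDr addnC.
- exists (a%:Z - b.+1%:Z); rewrite wE.
  have : (x ^+ (4 * a) * (x ^+ 2 * w * x ^+ 2) = x ^+ (4 * b.+1))%g.
    rewrite sandwich E -!expgnDr; congr (x ^+ _)%g.
    by rewrite mulnS addnAC.
  move=> /(congr1 GL3_val); rewrite scaleX rho4_tau4X mulrBr exprzDr // => F.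
  rewrite mulrC -scalerA -PoszM -exprnP F scale_scalar_mx.
  by rewrite exprnP -exprzDr // addNr expr0z.
Qed.

Theorem corollary2p4 :
  let t : laurent := laurentX in
  let T : 'M[laurent]_3 := rho4 tau in
  let D : 'M[laurent]_3 := rho4 Delta in
  injective rho4 <->
  (forall (m : int) (k : nat) (i : 'I_k -> nat),
     (1 <= k)%N ->
     (forall j : 'I_k, (1 <= i j <= 3)%N) ->
     t ^ (4 * m) *: (T ^+ 2 * D * (\prod_(j < k) (T ^+ i j * D)) * T ^+ 2)
       <> 1%:M).
Proof.
move=> t T D; split=> [inj m k i _ i13 E|neq].
- pose s := [seq i j | j <- index_enum 'I_k].
  have rs : reduced (rev s).
    by rewrite /reduced all_rev; apply/allP => _ /mapP[j _ ->].
  have [|a [b]] := (burau_product_group s).1.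
    by exists m; rewrite big_map.
  rewrite -{1}[s]revK -rho4_alternating -!rho4X -rho4M => /inj.
  rewrite -[alternating _ _ _ _]mulg1 -[X in (_ * X * _)%g](expg0 tau).
  rewrite -(commute_x4_alternating _ _ _ tau4_Delta2) expg0 mulg1.
  exact: alternating_braid_neq.
- apply/rho4_injP=> g g1.
  apply: rho4_inj_on_generated (rho4_ker_generated g g1) g1.
  move=> s a b s0 rs E.
  have [|m] := (burau_product_group s).2; first by exists a, b.
  rewrite (big_nth 0%N) big_mkord; apply: neq; first by rewrite lt0n size_eq0.
  by move=> j; move/allP: rs; apply; exact: mem_nth.
Qed.
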